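(* Consider the distributed matrix multiplication problem of computing $C=A^{\intercal}B$, with $A\in\mathbb{F}^{s\times r}$ and $B\in\mathbb{F}^{s\times t}$, using $N$ workers, with parameters $p,m,n$. Let $K_{\textup{entangled-poly}}\triangleq pmn+p-1$ if $N\ge pmn+p-1$, and $K_{\textup{entangled-poly}}\triangleq N$ if $N<pmn+p-1$. If $m=1$ or $n=1$, then the entangled polynomial code can detect up to $$E^*_{\textup{detect}}=N-K_{\textup{entangled-poly}}$$ errors, and correct up to $$E^*_{\textup{correct}}=\left\lfloor\frac{N-K_{\textup{entangled-poly}}}{2}\right\rfloor$$ errors. This cannot be improved using any other linear encoding functions; that is, these values are the maxima of $E_{\textup{detect}}(\boldsymbol f,\boldsymbol g)$ and of $E_{\textup{correct}}(\boldsymbol f,\boldsymbol g)$, respectively, over all linear encoding functions $(\boldsymbol f,\boldsymbol g)$.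
   Context: Setting. $p,m,n,N,s,r,t$ are positive integers with $p\mid s$, $m\mid r$, $n\mid t$, and $\mathbb{F}$ is a (finite or infinite) field that is sufficiently large, i.e. $|\mathbb F|\ge q_0$ for some threshold $q_0$ depending only on $p,m,n,N$. There are $N$ workers, indexed $0,\dots,N-1$. Encoding functions are $\boldsymbol f=(f_0,\dots,f_{N-1})$, $f_i:\mathbb F^{s\times r}\to\mathbb F^{\frac sp\times\frac rm}$, and $\boldsymbol g=(g_0,\dots,g_{N-1})$, $g_i:\mathbb F^{s\times t}\to\mathbb F^{\frac sp\times\frac tn}$. Worker $i$ stores $\tilde A_i=f_i(A)$, $\tilde B_i=g_i(B)$ and its correct result is $\tilde C_i=\tilde A_i^{\intercal}\tilde B_i$. Linear encoding. Partition $A$ into $p\times m$ equal-size blocks $A_{j,k}\in\mathbb F^{\frac sp\times\frac rm}$ and $B$ into $p\times n$ equal-size blocks $B_{j,k}\in\mathbb F^{\frac sp\times\frac tn}$. The encoding functions are linear if there are scalars $a_{ijk},b_{ijk}\in\mathbb F$ with $\tilde A_i=\sum_{j,k}A_{j,k}a_{ijk}$ and $\tilde B_i=\sum_{j,k}B_{j,k}b_{ijk}$ for each $i$. Fault-tolerant computing. The master receives a result from every worker, but some workers may return arbitrary erroneous matrices in place of $\tilde C_i$, and the master does not know which. A decoding function maps the $N$ received matrices either to an estimate of $C$ or to an ''error'' report; it is required to be valid, i.e. it returns $C=A^{\intercal}B$ for all inputs $A,B$ whenever no worker is in error. The encoding functions $(\boldsymbol f,\boldsymbol g)$ can detect $E$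 errors if there is a valid decoding function that, for all inputs, either returns the correct $C$ or reports an error whenever at most $E$ workers are in error; they can correct $E$ errors if there is a valid decoding function that, for all inputs, always returns the correct $C$ whenever at most $E$ workers are in error. $E_{\textup{detect}}(\boldsymbol f,\boldsymbol g)$ and $E_{\textup{correct}}(\boldsymbol f,\boldsymbol g)$ denote the maximum such $E$ in the two cases. $E^*_{\textup{detect}}$ and $E^*_{\textup{correct}}$ denote the maxima of these quantities over all linear encoding functions (for which a valid decoding function exists). Entangled polynomial code. For $N\ge pmn+p-1$, choose distinct $x_0,\dots,x_{N-1}\in\mathbb F$ and set $$\tilde A_i=\sum_{j=0}^{p-1}\sum_{k=0}^{m-1}A_{j,k}\,x_i^{\,j+kp},\qquad \tilde B_i=\sum_{j=0}^{p-1}\sum_{k=0}^{n-1}B_{j,k}\,x_i^{\,p-1-j+kpm}.$$ For $N<pmn+p-1$, the name refers by convention to any linear encoding functions for which $C$ can be recovered from the correct results of all $N$ workers. Standing assumption: $N$ is large enough that at least one choice of linear encoding functions allows $C$ to be recovered from the correct results of all $N$ workers. *)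

(* Defs.v *)
From mathcomp Require Import all_boot all_order all_algebra.

Set Implicit Arguments.
Unset Strict Implicit.
Unset Printing Implicit Defensive.

Import GRing.Theory.
Local Open Scope ring_scope.

Definition is_max (P : nat -> Prop) (E : nat) : Prop :=
  P E /\ forall E' : nat, P E' -> (E' <= E)%N.

Definition has_at_least (q : nat) (F : fieldType) : Prop :=
  exists e : 'I_q -> F, injective e.

Fact block_idx_subproof (d b : nat) (j : 'I_d) (u : 'I_(b %/ d)) :
  (j * (b %/ d) + u < b)%N.
Proof.
apply: (@leq_trans (j.+1 * (b %/ d))); first by rewrite mulSn addnC ltn_add2r.
by apply: leq_trans (leq_divM b d); rewrite mulnC leq_mul2l (ltn_ord j) orbT.
Qed.

(* The position, in 0..b-1, of the u-th element of the j-th of d consecutive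
   intervals of length b %/ d; these intervals cover 0..b-1 when d %| b. *)
Definition block_idx (d b : nat) (j : 'I_d) (u : 'I_(b %/ d)) : 'I_b :=
  Ordinal (block_idx_subproof j u).

Definition block (F : fieldType) (d e b c : nat) (A : 'M[F]_(b, c))
    (j : 'I_d) (k : 'I_e) : 'M[F]_(b %/ d, c %/ e) :=
  mxsub (@block_idx d b j) (@block_idx e c k) A.

Definition encoding (F : fieldType) (N d e b c : nat) : Type :=
  'I_N -> 'M[F]_(b, c) -> 'M[F]_(b %/ d, c %/ e).

Definition linear_encoding (F : fieldType) (N d e b c : nat)
    (f : encoding F N d e b c) : Prop :=
  exists a : 'I_N -> 'I_d -> 'I_e -> F,
  forall (i : 'I_N) (A : 'M[F]_(b, c)),
    f i A = \sum_(j < d) \sum_(k < e) a i j k *: block A j k.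

Section Computation.

Variables (F : fieldType) (N p m n s r t : nat).
Implicit Types (f : encoding F N p m s r) (g : encoding F N p n s t).

Definition linear_code f g : Prop := linear_encoding f /\ linear_encoding g.

Definition results f g (A : 'M[F]_(s, r)) (B : 'M[F]_(s, t)) :
    {ffun 'I_N -> 'M[F]_(r %/ m, t %/ n)} :=
  [ffun i => (f i A)^T *m g i B].

(* [None] is the error report. *)
Definition decoder : Type :=
  {ffun 'I_N -> 'M[F]_(r %/ m, t %/ n)} -> option 'M[F]_(r, t).

Definition valid_decoder f g (dec : decoder) : Prop :=
  forall (A : 'M[F]_(s, r)) (B : 'M[F]_(s, t)),
    dec (results f g A B) = Some (A^T *m B).

Definition recoverable f g : Prop := exists dec : decoder, valid_decoder f g dec.

(* X is the set of workers in error; their returned matrices are arbitrary. *)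
Definition received f g (A : 'M[F]_(s, r)) (B : 'M[F]_(s, t)) (E : nat)
    (y : {ffun 'I_N -> 'M[F]_(r %/ m, t %/ n)}) : Prop :=
  exists X : {set 'I_N}, (#|X| <= E)%N /\
    forall i : 'I_N, i \notin X -> y i = results f g A B i.

Definition can_detect f g (E : nat) : Prop :=
  exists dec : decoder, valid_decoder f g dec /\
    forall A B y, received f g A B E y ->
      dec y = Some (A^T *m B) \/ dec y = None.

Definition can_correct f g (E : nat) : Prop :=
  exists dec : decoder, valid_decoder f g dec /\
    forall A B y, received f g A B E y -> dec y = Some (A^T *m B).

Definition is_E_detect f g (E : nat) : Prop := is_max (can_detect f g) E.

Definition is_E_correct f g (E : nat) : Prop := is_max (can_correct f g) E.

(* E is the maximum of the quantity [val] over the recoverable linear codes,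
   including that [val] is defined for each of them. *)
Definition is_max_over_linear
    (val : encoding F N p m s r -> encoding F N p n s t -> nat -> Prop)
    (E : nat) : Prop :=
  (exists f g, [/\ linear_code f g, recoverable f g & val f g E]) /\
  (forall f g, linear_code f g -> recoverable f g ->
    exists E' : nat, val f g E' /\ (E' <= E)%N).

Definition is_E_detect_star : nat -> Prop := is_max_over_linear is_E_detect.

Definition is_E_correct_star : nat -> Prop := is_max_over_linear is_E_correct.

Definition entangled_poly_encoding f g (x : 'I_N -> F) : Prop :=
  (forall i A, f i A =
     \sum_(j < p) \sum_(k < m) x i ^+ (j + k * p) *: block A j k) /\
  (forall i B, g i B =
     \sum_(j < p) \sum_(k < n) x i ^+ (p - 1 - j + k * p * m) *: block B j k).

Definition entangled_poly_code f g : Prop :=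
  if (p * m * n + p - 1 <= N)%N then
    exists x : 'I_N -> F, injective x /\ entangled_poly_encoding f g x
  else linear_code f g /\ recoverable f g.

End Computation.

Definition K_entangled_poly (p m n N : nat) : nat :=
  if (p * m * n + p - 1 <= N)%N then (p * m * n + p - 1)%N else N.

(* Main.v *)
(* A code detects E errors iff inputs with different products give results at
   Hamming distance more than E, and corrects E errors iff that distance is more
   than 2E, so the theorem says that the best minimum distance is N - K + 1.

   For the entangled code, the entries of the results are the values at the x_i
   of polynomials of degree at most pmn + p - 2 that have the entries of C among
   their coefficients; if the products differ, two of these polynomials differ,
   and they agree at no more than pmn + p - 2 points.

   Conversely, let n = 1 (the case m = 1 is symmetric) and take any linear code
   and any K <= pm + p - 1 workers.  There are A and B with A^T B <> 0 such that
   all but one of these K workers have a zero encoding of A or of B, hence return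
   what they would return for A = B = 0.  Blocks with a single nonzero entry
   reduce this to 1 x 1 blocks, where it is linear algebra (one_survivor). *)
Require Import Defs.
From mathcomp Require Import all_boot all_order all_algebra.
From mathcomp Require Import zify.
From Stdlib Require Import ClassicalEpsilon.

Set Implicit Arguments.
Unset Strict Implicit.
Unset Printing Implicit Defensive.

Import GRing.Theory.
Local Open Scope ring_scope.

(** * Linear algebra behind the upper bound *)

Lemma mx_neq0P (R : nmodType) (m n : nat) (A : 'M[R]_(m, n)) :
  A != 0 -> exists i j, A i j != 0.
Proof.
move=> A0; case: (pickP (fun ij : 'I_m * 'I_n => A ij.1 ij.2 != 0)) => [[i j]|z].
  by exists i, j.
by case/eqP: A0; apply/matrixP=> i j; rewrite mxE; apply/eqP/negbFE/(z (i, j)).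
Qed.

Lemma ker_col (F : fieldType) (k q : nat) (M : 'M[F]_(k, q)) :
  ~~ row_full M -> exists2 x : 'rV[F]_q, x != 0 & M *m x^T = 0.
Proof.
rewrite -cokermx_eq0 => /mx_neq0P[i [j ij0]].
exists (col j (cokermx M))^T.
  by apply: contraNneq ij0 => /matrixP/(_ 0 i); rewrite !mxE => ->.
by rewrite trmxK colE mulmxA mulmx_coker mul0mx.
Qed.

(* If the rows of [a] do not span, some A is annihilated by all of them.
   Otherwise they contain a basis T whose complement has fewer than p elements,
   so some u <> 0 is annihilated by the rows of [b] off T.  The members of the
   basis dual to T are annihilated by the rows of [a] in T except one, and they
   span, so u *m A <> 0 for one of them. *)
Lemma one_survivor (F : fieldType) (p e K : nat) (a : 'M[F]_(K, p * e))
    (b : 'M[F]_(K, p)) :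
  (0 < p)%N -> (0 < e)%N -> (0 < K)%N -> (K < p * e + p)%N ->
  exists (u : 'rV[F]_p) (A : 'M[F]_(p, e)) (j : 'I_K), u *m A != 0 /\
    forall i, i != j ->
      (a *m (mxvec A)^T) i 0 = 0 \/ (b *m u^T) i 0 = 0.
Proof.
move=> p0 e0 K0 ltK; case: (boolP (row_full a)) => [fa|/ker_col[x x0 ax]].
  pose f := fullrankfun fa; pose T := [set f l | l : 'I_(p * e)].
  have cT : #|~: T| = (K - p * e)%N.
    by rewrite cardsCs setCK card_ord card_imset ?card_ord //; apply: fullrankfun_inj.
  have [|u u0 bu] := @ker_col _ _ _ (rowsub (@enum_val _ (mem (~: T))) b).
    by rewrite /row_full neq_ltn (leq_ltn_trans (rank_leq_row _)) // cT; lia.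
  have bu0 i : i \notin T -> (b *m u^T) i 0 = 0.
    move=> iT; have iT' : i \in ~: T by rewrite inE.
    have := congr1 (fun M : 'cV__ => M (enum_rank_in iT' i) 0) bu.
    rewrite !mxE => bu_i; rewrite -[RHS]bu_i; apply: eq_bigr => l _.
    by rewrite !mxE enum_rankK_in.
  pose W := invmx (rowsub f a).
  have WR : rowsub f a *m W = 1%:M by rewrite mulmxV ?fullrowsub_unit.
  have /mx_neq0P[l [k lk0]] : W^T *m lin_mul_row u != 0.
    have [i [j]] := mx_neq0P u0; rewrite (ord1 i) => uj0.
    apply: contraNneq uj0 => WL0.
    have /(congr1 (mulmx (rowsub f a)^T)) := WL0.
    rewrite mulmx0 mulmxA -trmx_mul.
    rewrite (mulmx1C WR) trmx1 mul1mx => L0.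
    (* If [A |-> u *m A] vanished identically, its value at this unit matrix, whose entry 0 is
       [u 0 j], would be zero. *)
    have := mul_vec_lin_row (delta_mx j (Ordinal e0)) u.
    rewrite L0 mulmx0 => /matrixP/(_ 0 (Ordinal e0)).
    rewrite !mxE (bigD1 j) //= !mxE !eqxx mulr1 big1 ?addr0 => [<- //|i' i'j].
    by rewrite mxE (negbTE i'j) mulr0.
  exists u, (vec_mx (row l W^T)), (f l); split.
    apply: contraNneq lk0 => uA0; have := mul_vec_lin_row (vec_mx (row l W^T)) u.
    by rewrite vec_mxK uA0 -row_mul => /matrixP/(_ 0 k); rewrite mxE => ->; rewrite mxE.
  move=> i il; case: (boolP (i \in T)) => [/imsetP[l' _ il']|/bu0]; last by right.
  left; rewrite vec_mxK; transitivity ((rowsub f a *m W) l' l).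
    by rewrite mxE [RHS]mxE; apply: eq_bigr => h _; rewrite !mxE il'.
  by rewrite WR mxE; case: eqVneq => // ll; case/eqP: il; rewrite il' ll.
have /mx_neq0P[j [k jk0]] : vec_mx x != 0.
  by apply: contraNneq x0 => x0; rewrite -[x]vec_mxK x0 linear0.
exists (delta_mx 0 j), (vec_mx x), (Ordinal K0); split.
  by apply: contraNneq jk0; rewrite -rowE => /matrixP/(_ 0 k); rewrite mxE [RHS]mxE => ->.
by move=> i _; left; rewrite vec_mxK ax mxE.
Qed.

(** * Block partitions and inflation of 1 x 1 blocks *)

Lemma block_idx_inj (d b : nat) (j j' : 'I_d) (u u' : 'I_(b %/ d)) :
  (block_idx j u == block_idx j' u') = (j == j') && (u == u').
Proof.
have b0 : (0 < b %/ d)%N by apply: leq_ltn_trans (ltn_ord u).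
apply/eqP/andP=> [/(congr1 val) /= e|[/eqP-> /eqP->]] //.
split; apply/eqP/val_inj => /=.
  have := congr1 (fun x => x %/ (b %/ d))%N e.
  by rewrite /= !divnMDl ?(divn_small (ltn_ord _)) ?addn0.
have := congr1 (fun x => x %% (b %/ d))%N e.
by rewrite /= !modnMDl ?(modn_small (ltn_ord _)).
Qed.

Lemma block_idx_bij (d b : nat) : (d %| b)%N ->
  bijective (fun ju : 'I_d * 'I_(b %/ d) => block_idx ju.1 ju.2).
Proof.
move=> db; apply: inj_card_bij => [[j u] [j' u'] /= /eqP|].
  by rewrite block_idx_inj => /andP[/eqP-> /eqP->].
by rewrite card_prod !card_ord mulnC divnK.
Qed.

Lemma block_idxP (d b : nat) (x : 'I_b) : (d %| b)%N ->
  exists (j : 'I_d) (u : 'I_(b %/ d)), x = block_idx j u.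
Proof.
by move=> /block_idx_bij[h _ hK]; exists (h x).1, (h x).2; rewrite -[LHS]hK.
Qed.

Lemma block_mulmx (F : fieldType) (p m n s r t : nat) (A : 'M[F]_(s, r))
    (B : 'M[F]_(s, t)) (k : 'I_m) (l : 'I_n) :
  (p %| s)%N ->
  block (A^T *m B) k l = \sum_(j < p) (block A j k)^T *m block B j l.
Proof.
move=> /block_idx_bij ps; apply/matrixP=> u v; rewrite summxE mxE mxE.
rewrite (reindex _ (onW_bij _ ps)) /=.
rewrite -(pair_bigA _ (fun j w => A^T (block_idx k u) (block_idx j w)
                                   * B (block_idx j w) (block_idx l v))) /=.
by apply: eq_bigr => j _; rewrite mxE; apply: eq_bigr => w _; rewrite !mxE.
Qed.

Lemma block_inj (F : fieldType) (m n r t : nat) (C C' : 'M[F]_(r, t)) :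
  (m %| r)%N -> (n %| t)%N ->
  (forall (k : 'I_m) (l : 'I_n), block C k l = block C' k l) -> C = C'.
Proof.
move=> mr nt eqC; apply/matrixP=> x y.
have [k [u ->]] := block_idxP x mr; have [l [v ->]] := block_idxP y nt.
by have /matrixP/(_ u v) := eqC k l; rewrite !mxE.
Qed.

(** Column [j] is the unit vector at the start of the [j]-th interval. These columns are orthonormal
    when [d] divides a positive [b], which makes [corner] compatible with products. *)
Definition corner_row (F : fieldType) (d b : nat) : 'M[F]_(b, d) :=
  \matrix_(x, j) (x == j * (b %/ d) :> nat)%N%:R.

(* The (j, k) block of the result is zero except for its top left entry [A j k]. *)
Definition corner (F : fieldType) (d e b c : nat) (A : 'M[F]_(d, e)) :
    'M[F]_(b, c) :=
  corner_row F d b *m A *m (corner_row F e c)^T.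

Lemma corner_rowE (F : fieldType) (d b : nat) (j j' : 'I_d) (u : 'I_(b %/ d)) :
  corner_row F d b (block_idx j u) j' = ((j == j') && (u == 0 :> nat))%:R.
Proof.
have u0 : (0 < b %/ d)%N by apply: leq_ltn_trans (ltn_ord u).
rewrite mxE; have := block_idx_inj j j' u (Ordinal u0).
by rewrite -!(inj_eq val_inj) /= addn0 => ->.
Qed.

Lemma corner_rowK (F : fieldType) (d b : nat) : (0 < b)%N -> (d %| b)%N ->
  (corner_row F d b)^T *m corner_row F d b = 1%:M.
Proof.
move=> b0 db; have u0 : (0 < b %/ d)%N.
  by rewrite divn_gt0 ?(dvdn_gt0 b0 db) ?(dvdn_leq b0 db).
apply/matrixP=> j j'; rewrite !mxE (reindex _ (onW_bij _ (block_idx_bij db))) /=.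
rewrite (bigD1 (j, Ordinal u0)) //= mxE !corner_rowE eqxx /= mul1r andbT.
rewrite big1 ?addr0 // => -[i u] /= ne; rewrite mxE !corner_rowE.
case: eqP => [ij|_]; last by rewrite mul0r.
case: eqP => [uz|_]; last by rewrite mul0r.
by case/eqP: ne; rewrite ij; congr pair; apply: val_inj.
Qed.

Lemma corner_block (F : fieldType) (d e b c : nat) (A : 'M[F]_(d, e)) j k :
  block (corner b c A) j k =
  A j k *: \matrix_(u, v) ((u == 0 :> nat) && (v == 0 :> nat))%:R.
Proof.
apply/matrixP=> u v; rewrite !mxE (bigD1 k) //= mxE (bigD1 j) //=.
rewrite [(_)^T _ _]mxE !corner_rowE !eqxx /= !big1 ?addr0.
- by case: eqP; case: eqP; rewrite /= ?mul0r ?mul1r ?mulr0 ?mulr1.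
- by move=> k' k'k; rewrite [(_)^T _ _]mxE corner_rowE eq_sym (negbTE k'k) mulr0.
- by move=> j' j'j; rewrite corner_rowE eq_sym (negbTE j'j) mul0r.
Qed.

Lemma corner_mul (F : fieldType) (p m n s r t : nat) (A : 'M[F]_(p, m))
    (B : 'M[F]_(p, n)) :
  (0 < s)%N -> (p %| s)%N ->
  (corner s r A)^T *m corner s t B = corner r t (A^T *m B).
Proof.
move=> s0 ps; rewrite /corner !trmx_mul trmxK !mulmxA.
by rewrite -(mulmxA _ _ (corner_row F p s)) corner_rowK // mulmx1.
Qed.

Lemma corner_eq0 (F : fieldType) (m n r t : nat) (C : 'M[F]_(m, n)) :
  (0 < r)%N -> (0 < t)%N -> (m %| r)%N -> (n %| t)%N ->
  corner r t C = 0 -> C = 0.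
Proof.
move=> r0 t0 mr nt C0.
have := congr1 (fun M => (corner_row F m r)^T *m M *m corner_row F n t) C0.
by rewrite /corner mulmx0 mul0mx -!mulmxA corner_rowK // mulmx1 mulmxA corner_rowK // mul1mx.
Qed.

(** * Upper bound on the minimum distance of linear codes *)

Lemma mxvec_dot (F : fieldType) (p e : nat) (X A : 'M[F]_(p, e)) :
  (mxvec X *m (mxvec A)^T) 0 0 = \sum_(j < p) \sum_(k < e) X j k * A j k.
Proof.
rewrite mxE pair_bigA /= (reindex _ (curry_mxvec_bij p e)) /=.
by apply: eq_bigr => -[j k] _; rewrite mxE !mxvecE.
Qed.

Lemma confusable_inputs (F : fieldType) (p m n K : nat)
    (a : 'I_K -> 'I_p -> 'I_m -> F) (b : 'I_K -> 'I_p -> 'I_n -> F) :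
  (0 < p)%N -> (0 < m)%N -> (0 < n)%N -> m = 1%N \/ n = 1%N ->
  (0 < K)%N -> (K < p * m * n + p)%N ->
  exists (A : 'M[F]_(p, m)) (B : 'M[F]_(p, n)) (i0 : 'I_K), A^T *m B != 0 /\
    forall i, i != i0 ->
      \sum_(j < p) \sum_(k < m) a i j k * A j k = 0 \/
      \sum_(j < p) \sum_(k < n) b i j k * B j k = 0.
Proof.
have vecE e (c : 'I_K -> 'I_p -> 'I_e -> F) (A : 'M_(p, e)) i :
    ((\matrix_i mxvec (\matrix_(j, k) c i j k)) *m (mxvec A)^T) i 0
    = \sum_(j < p) \sum_(k < e) c i j k * A j k.
  transitivity ((mxvec (\matrix_(j, k) c i j k) *m (mxvec A)^T) 0 0).
    by rewrite -(rowK (fun i => mxvec (\matrix_(j, k) c i j k))) -row_mul [RHS]mxE.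
  by rewrite mxvec_dot; do 2!apply: eq_bigr => ? _; rewrite mxE.
have colE (c : 'I_K -> 'I_p -> 'I_1 -> F) (u : 'rV_p) i :
    ((\matrix_(i, j) c i j 0) *m u^T) i 0
    = \sum_(j < p) \sum_(k < 1) c i j k * u^T j k.
  by rewrite mxE; apply: eq_bigr => j _; rewrite big_ord1 mxE.
(* The operand with a single block column is the vector [u] of [one_survivor], transposed. For
   [n = 1] the product is the transpose of [u *m A]. *)
move=> p0 m0 n0 mn1 K0 ltK; case: mn1 => e1; subst.
  have [|u [A [i0 [uA0 h]]]] := @one_survivor _ _ _ _
    (\matrix_i mxvec (\matrix_(j, k) b i j k)) (\matrix_(i, j) a i j 0) p0 n0 K0.
    by rewrite muln1 in ltK.
  exists u^T, A, i0; rewrite trmxK; split=> // i /h; rewrite vecE colE.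
  by case; [right | left].
have [|u [A [i0 [uA0 h]]]] := @one_survivor _ _ _ _
  (\matrix_i mxvec (\matrix_(j, k) a i j k)) (\matrix_(i, j) b i j 0) p0 m0 K0.
  by rewrite muln1 in ltK.
exists A, u^T, i0; rewrite -trmx_mul trmx_eq0; split=> // i /h.
by rewrite vecE colE.
Qed.

(** The minimum distance exceeds [E], where inputs with the same product count as one message. *)
Definition separating (F : fieldType) (N p m n s r t : nat)
    (f : encoding F N p m s r) (g : encoding F N p n s t) (E : nat) : Prop :=
  forall A B A' B', A^T *m B != A'^T *m B' ->
    (E < #|[set i | results f g A B i != results f g A' B' i]|)%N.

(** All blocks of [corner b c A] are multiples of one fixed matrix, so the encoding is that matrix
    scaled by the encoding of [A] with 1 x 1 blocks. *)
Lemma encode_corner (F : fieldType) (N d e b c : nat)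
    (f : encoding F N d e b c) (a : 'I_N -> 'I_d -> 'I_e -> F)
    (A : 'M[F]_(d, e)) (i : 'I_N) :
  (forall i A, f i A = \sum_(j < d) \sum_(k < e) a i j k *: block A j k) ->
  \sum_(j < d) \sum_(k < e) a i j k * A j k = 0 ->
  f i (corner b c A) = 0.
Proof.
move=> fE a0; rewrite fE.
under eq_bigr do under eq_bigr do rewrite corner_block scalerA.
by under eq_bigr do rewrite -scaler_suml; rewrite -scaler_suml a0 scale0r.
Qed.

(** Apply [confusable_inputs] to the first [K] workers and inflate the inputs by [corner]. Against
    zero inputs, the products differ while at least [K - 1] results agree, so [E < N - K + 1]. *)
Lemma separating_le (F : fieldType) (N p m n s r t : nat)
    (f : encoding F N p m s r) (g : encoding F N p n s t) (E : nat) :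
  (0 < p)%N -> (0 < m)%N -> (0 < n)%N -> (0 < N)%N ->
  (0 < s)%N -> (0 < r)%N -> (0 < t)%N ->
  (p %| s)%N -> (m %| r)%N -> (n %| t)%N -> m = 1%N \/ n = 1%N ->
  linear_code f g -> separating f g E -> (E <= N - K_entangled_poly p m n N)%N.
Proof.
move=> p0 m0 n0 N0 s0 r0 t0 ps mr nt mn1 [[a fE] [b gE]] sepE.
set K := K_entangled_poly p m n N.
have [KN K0 ltK] : [/\ (K <= N)%N, (0 < K)%N & (K < p * m * n + p)%N].
  have : (0 < p * m * n)%N by rewrite !muln_gt0 p0 m0.
  by rewrite /K /K_entangled_poly; case: (leqP (p * m * n + p - 1)); split; lia.
pose w := widen_ord KN.
have [A [B [i0 [AB0 h]]]] := confusable_inputs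
  (fun i => a (w i)) (fun i => b (w i)) p0 m0 n0 mn1 K0 ltK.
have /sepE : (corner s r A)^T *m corner s t B != (0 : 'M_(s, r))^T *m (0 : 'M_(s, t)).
  by rewrite mulmx0 corner_mul //; apply: contraNneq AB0 => /corner_eq0->.
have zero i : i != i0 ->
    results f g (corner s r A) (corner s t B) (w i) = results f g 0 0 (w i).
  have g0 : g (w i) 0 = 0.
    by rewrite gE big1 // => j _; rewrite big1 // => k _; rewrite /block linear0 scaler0.
  rewrite !ffunE g0 mulmx0 => /h[/(encode_corner fE)->|/(encode_corner gE)->].
    by rewrite trmx0 mul0mx.
  by rewrite mulmx0.
set D := [set i | _] => ltE.
have sub : w @: [set~ i0] \subset ~: D.
  by apply/subsetP=> _ /imsetP[i + ->]; rewrite !inE negbK => /zero->.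
have := subset_leq_card sub.
have w_inj : injective w by move=> i j /(congr1 val) /= /val_inj.
have := cardsC D.
rewrite card_imset // cardsC1 !card_ord; lia.
Qed.

(** * Decoders and minimum distance *)

(** Source of the decoders: [Q y C] will say that the product [C] is compatible with the received
    [y], and [None] reports that no product is. *)
Lemma partial_choice (T U : Type) (Q : T -> U -> Prop) :
  exists h : T -> option U,
    forall y, if h y is Some C then Q y C else forall C, ~ Q y C.
Proof.
exists (fun y => match excluded_middle_informative (exists C, Q y C) with
  | left ex => Some (proj1_sig (constructive_indefinite_description _ ex))
  | right _ => None end) => y.
case: excluded_middle_informative => [ex|nex C QyC]; last by apply: nex; exists C.
by case: constructive_indefinite_description.
Qed.

(** Correct results for one input pair within distance [E] of those for another would pass for an
    erroneous word of the latter. Conversely, accept exactly the words that are correct results of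
    some inputs. *)
Lemma can_detectP (F : fieldType) (N p m n s r t : nat)
    (f : encoding F N p m s r) (g : encoding F N p n s t) (E : nat) :
  can_detect f g E <-> separating f g E.
Proof.
split=> [[dec [val det]] A B A' B' neC|sepE].
  rewrite ltnNge; apply: contraNN neC => leE; apply/eqP.
  have : received f g A B E (results f g A' B').
    exists [set i | results f g A B i != results f g A' B' i]; split=> // i.
    by rewrite inE negbK => /eqP.
  by move/det; rewrite val => -[[->]|].
have [dec decP] := partial_choice
  (fun y C => exists A B, results f g A B = y /\ C = A^T *m B).
have det A B y : received f g A B E y -> dec y = Some (A^T *m B) \/ dec y = None.
  have := decP y; case: (dec y) => [_ [A' [B' [<- ->]]] [X [leX eqX]]|]; last by right.
  left; congr Some; apply/eqP; apply: contraLR leX; rewrite -ltnNge eq_sym => neC.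
  apply: leq_trans (sepE _ _ _ _ neC) (subset_leq_card _).
  by apply/subsetP=> i; rewrite inE; apply: contraNT => /eqX->.
exists dec; split=> // A B.
have [||none] // := det A B (results f g A B); first by exists set0; rewrite cards0.
by have := decP (results f g A B); rewrite none => /(_ (A^T *m B)) []; exists A, B.
Qed.

Lemma can_correctP (F : fieldType) (N p m n s r t : nat)
    (f : encoding F N p m s r) (g : encoding F N p n s t) (E : nat) :
  can_correct f g E <-> separating f g (E * 2).
Proof.
split=> [[dec [val cor]] A B A' B' neC|sepE].
  rewrite ltnNge; apply: contraNN neC; set D := [set i | _] => leD; apply/eqP.
  (* Split [D] into [X] and [D :\: X], each of size at most [E]. The word [y] switches from one
     result vector to the other on [X], so it can be received for both input pairs. *)
  have [e [e_uniq sz_e eD]] := card_geqP (geq_minr E #|D|).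
  pose X := [set i in e].
  have cX : #|X| = minn E #|D| by rewrite cardsE (card_uniqP e_uniq).
  have XD : X \subset D by apply/subsetP=> i; rewrite inE => /eD.
  pose y := [ffun i => if i \in X then results f g A' B' i else results f g A B i].
  have ABy : received f g A B E y.
    exists X; split; first by rewrite cX geq_minl.
    by move=> i iX; rewrite ffunE (negbTE iX).
  have A'B'y : received f g A' B' E y.
    exists (D :\: X); split.
      by rewrite cardsDS // cX; move: leD; move: #|D| => d; lia.
    move=> i; rewrite !inE negb_and !negbK [y i]ffunE inE.
    by case: ifP => //= _ /eqP.
  by have := cor _ _ _ ABy; rewrite (cor _ _ _ A'B'y) => -[].
have [dec decP] := partial_choice
  (fun y C => exists A B, received f g A B E y /\ C = A^T *m B).
have cor A B y : received f g A B E y -> dec y = Some (A^T *m B).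
  have := decP y; case: (dec y) => [_ [A' [B' [[X' [leX' eqX']] ->]]] [X [leX eqX]]|].
    (* Triangle inequality: the two result vectors agree outside the two error sets, which have at
       most [2E] members together. *)
    congr Some; apply/eqP; have : (#|X :|: X'| <= E * 2)%N by rewrite cardsU; lia.
    apply: contraLR; rewrite -ltnNge eq_sym => neC.
    apply: leq_trans (sepE _ _ _ _ neC) (subset_leq_card _).
    apply/subsetP=> i; rewrite inE in_setU; apply: contraNT.
    by rewrite negb_or => /andP[/eqX<- /eqX'<-].
  by move=> none recv; case: (none (A^T *m B)); exists A, B.
exists dec; split=> // A B; apply: cor; exists set0; rewrite cards0.
by split.
Qed.

(** [is_max_over_linear] demands that the maximum exist for every recoverable code. [P] need not be
    decidable, hence excluded middle. *)
Lemma is_max_exists (P : nat -> Prop) (b : nat) :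
  P 0%N -> (forall E, P E -> (E <= b)%N) -> exists E, is_max P E /\ (E <= b)%N.
Proof.
elim: b => [|b IH] P0 Pb; first by exists 0%N; split=> //; split.
case: (excluded_middle_informative (P b.+1)) => [Pb1|nP].
  by exists b.+1; split=> //; split.
have [|E [maxE leE]] := IH P0; last by exists E; split=> //; apply: leqW.
by move=> E PE; rewrite -ltnS ltn_neqAle Pb // andbT; apply/eqP=> eE; rewrite eE in PE.
Qed.

(** * Polynomials of the entangled code *)

(** After [j'] is moved across, both sides are mixed-radix numerals with a digit in base [p], a
    digit in base [m] and an unbounded leading digit; compare digit by digit. *)
Lemma entangled_exponent (p m j k j' l k0 l0 : nat) :
  (j < p)%N -> (j' < p)%N -> (k < m)%N -> (k0 < m)%N ->
  (p - 1 + k0 * p + l0 * p * m == j + k * p + (p - 1 - j' + l * p * m))%N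
  = [&& j == j', k == k0 & l == l0].
Proof.
move=> jp j'p km k0m; apply/eqP/and3P => [e|[/eqP-> /eqP-> /eqP->]]; last by lia.
have {}e : ((k0 + l0 * m) * p + j' = (k + l * m) * p + j)%N by lia.
have jj : j = j'.
  by have := congr1 (fun x => x %% p)%N e; rewrite /= !modnMDl !modn_small.
have p0 : (0 < p)%N by lia.
have {}e : (l0 * m + k0 = l * m + k)%N.
  by apply/eqP; rewrite -(eqn_pmul2r p0); apply/eqP; lia.
have kk : k = k0.
  by have := congr1 (fun x => x %% m)%N e; rewrite /= !modnMDl !modn_small.
have m0 : (0 < m)%N by lia.
split; apply/eqP=> //; apply/eqP.
by rewrite -(eqn_pmul2r m0); apply/eqP; lia.
Qed.

(** Entry [(u, v)] of the product of the two encoding polynomials, expanded into monomials so that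
    coefficients can be read off. *)
Definition result_poly (F : fieldType) (p m n s r t : nat) (A : 'M[F]_(s, r))
    (B : 'M[F]_(s, t)) (u : 'I_(r %/ m)) (v : 'I_(t %/ n)) : {poly F} :=
  \sum_(j < p) \sum_(k < m) \sum_(j' < p) \sum_(l < n)
    ((block A j k)^T *m block B j' l) u v
      *: 'X^(j + k * p + (p - 1 - j' + l * p * m)).

Lemma result_polyE (F : fieldType) (N p m n s r t : nat)
    (f : encoding F N p m s r) (g : encoding F N p n s t) (x : 'I_N -> F)
    A B i u v :
  entangled_poly_encoding f g x ->
  results f g A B i u v = (result_poly p A B u v).[x i].
move=> [fE gE]; rewrite ffunE fE gE (raddf_sum trmx) mulmx_suml summxE.
rewrite /result_poly horner_sum; apply: eq_bigr => j _.
rewrite (raddf_sum trmx) mulmx_suml summxE horner_sum; apply: eq_bigr => k _.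
rewrite mulmx_sumr summxE horner_sum; apply: eq_bigr => j' _.
rewrite mulmx_sumr summxE horner_sum; apply: eq_bigr => l _.
rewrite /= [trmx (_ *: _)]linearZ /= -scalemxAl -scalemxAr scalerA -exprD.
by rewrite hornerZ hornerXn mxE mulrC.
Qed.

Lemma size_result_poly (F : fieldType) (p m n s r t : nat)
    (A : 'M[F]_(s, r)) (B : 'M[F]_(s, t)) (u : 'I_(r %/ m)) (v : 'I_(t %/ n)) :
  (size (result_poly p A B u v) <= p * m * n + p - 1)%N.
Proof.
apply: leq_trans (size_sum _ _ _) _; apply/bigmax_leqP => j _.
apply: leq_trans (size_sum _ _ _) _; apply/bigmax_leqP => k _.
apply: leq_trans (size_sum _ _ _) _; apply/bigmax_leqP => j' _.
apply: leq_trans (size_sum _ _ _) _; apply/bigmax_leqP => l _.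
apply: leq_trans (size_scale_leq _ _) _; rewrite size_polyXn.
(* The exponent is largest at [j = p - 1], [k = m - 1], [j' = 0], [l = n - 1], where it equals
   [pmn + p - 2]. *)
have := leq_mul (ltn_ord k) (leqnn p); have := leq_mul (ltn_ord l) (leqnn (p * m)).
by have := ltn_ord j; have := ltn_ord j'; rewrite !mulSn; lia.
Qed.

(** By [entangled_exponent] only the terms with [j' = j] and the given [k], [l] reach this degree;
    their sum over [j] is the block product. *)
Lemma coef_result_poly (F : fieldType) (p m n s r t : nat)
    (A : 'M[F]_(s, r)) (B : 'M[F]_(s, t)) (u : 'I_(r %/ m)) (v : 'I_(t %/ n))
    (k : 'I_m) (l : 'I_n) : (p %| s)%N ->
  (result_poly p A B u v)`_(p - 1 + k * p + l * p * m)
  = block (A^T *m B) k l u v.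
Proof.
move=> ps; rewrite (block_mulmx _ _ _ _ ps) summxE coef_sum.
apply: eq_bigr => j _; rewrite coef_sum (bigD1 k) //= [X in _ + X]big1 ?addr0.
  rewrite coef_sum (bigD1 j) //= [X in _ + X]big1 ?addr0.
    rewrite coef_sum (bigD1 l) //= [X in _ + X]big1 ?addr0.
      by rewrite coefZ coefXn entangled_exponent // !eqxx mulr1.
    move=> l' ne; rewrite coefZ coefXn entangled_exponent //.
    by rewrite (inj_eq val_inj l') (negbTE ne) !andbF mulr0.
  move=> j' ne; rewrite coef_sum big1 // => l' _; rewrite coefZ coefXn.
  by rewrite entangled_exponent // (inj_eq val_inj) eq_sym (negbTE ne) mulr0.
move=> k' ne; rewrite coef_sum big1 // => j' _; rewrite coef_sum big1 // => l' _.
rewrite coefZ coefXn entangled_exponent //.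
by rewrite (inj_eq val_inj k') (negbTE ne) !andbF mulr0.
Qed.

Lemma entangled_separating (F : fieldType) (N p m n s r t : nat)
    (f : encoding F N p m s r) (g : encoding F N p n s t) (x : 'I_N -> F) :
  (p %| s)%N -> (m %| r)%N -> (n %| t)%N ->
  injective x -> entangled_poly_encoding f g x ->
  (p * m * n + p - 1 <= N)%N -> separating f g (N - (p * m * n + p - 1)).
Proof.
move=> ps mr nt x_inj fgx leN A B A' B'; apply: contraNT; set D := [set i | _].
rewrite -leqNgt => leD; apply/eqP/(block_inj mr nt) => k l; apply/matrixP=> u v.
rewrite -!(coef_result_poly _ _ _ _ _ _ ps).
apply/eqP; rewrite -subr_eq0 -coefB.
set P := _ - _; suff -> : P = 0 by rewrite coef0.
apply/eqP; apply: contraTT leD => P0; rewrite -ltnNge.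
have sizeP : (size P <= p * m * n + p - 1)%N.
  apply: leq_trans (size_polyD _ _) _.
  by rewrite size_polyN geq_max !size_result_poly.
(* Each worker outside [D] gives a distinct root [x i] of [P], and a nonzero polynomial has fewer
   roots than its [size]. *)
have : (size (map x (enum (~: D))) < size P)%N.
  apply: max_poly_roots => //; last by rewrite map_inj_uniq ?enum_uniq.
  apply/allP=> _ /mapP[i + ->]; rewrite mem_enum !inE negbK => /eqP eqi.
  by rewrite /root hornerD hornerN -!(result_polyE _ _ _ _ _ fgx) eqi subrr.
by rewrite size_map -cardE; have := cardsC D; rewrite card_ord; lia.
Qed.

(** * Optimality of the entangled code *)

Lemma entangled_linear (F : fieldType) (N p m n s r t : nat)
    (f : encoding F N p m s r) (g : encoding F N p n s t) (x : 'I_N -> F) :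
  entangled_poly_encoding f g x -> linear_code f g.
Proof.
move=> [fE gE]; split.
  by exists (fun i j k => x i ^+ (j + k * p)) => i A; rewrite fE.
by exists (fun i j k => x i ^+ (p - 1 - j + k * p * m)) => i B; rewrite gE.
Qed.

Lemma recoverableP (F : fieldType) (N p m n s r t : nat)
    (f : encoding F N p m s r) (g : encoding F N p n s t) :
  recoverable f g <-> separating f g 0.
Proof.
split=> [[dec val]|/can_detectP[dec [val _]]]; last by exists dec.
move=> A B A' B'; apply: contraNT; rewrite -eqn0Ngt cards_eq0 => /eqP D0.
have eqr : results f g A B = results f g A' B'.
  apply/ffunP=> i; apply/eqP; apply: contraFT (in_set0 i) => ne.
  by rewrite -D0 inE.
by have := val A B; rewrite eqr val => -[->].
Qed.

Theorem theorem5 (p m n N : nat)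
    (hp : (0 < p)%N) (hm : (0 < m)%N) (hn : (0 < n)%N) (hN : (0 < N)%N) :
  exists q0 : nat,
  forall F : fieldType, has_at_least q0 F ->
  forall s r t : nat,
    (0 < s)%N -> (0 < r)%N -> (0 < t)%N ->
    (p %| s)%N -> (m %| r)%N -> (n %| t)%N ->
    (* at least one linear code allows recovery from all N workers *)
    (exists (f : encoding F N p m s r) (g : encoding F N p n s t),
       linear_code f g /\ recoverable f g) ->
    m = 1%N \/ n = 1%N ->
    [/\ (exists (f : encoding F N p m s r) (g : encoding F N p n s t),
           entangled_poly_code f g),
        (forall (f : encoding F N p m s r) (g : encoding F N p n s t),
           entangled_poly_code f g ->
           is_E_detect f g (N - K_entangled_poly p m n N)%N /\
           is_E_correct f g ((N - K_entangled_poly p m n N) %/ 2)%N),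
        is_E_detect_star F N p m n s r t (N - K_entangled_poly p m n N)%N &
        is_E_correct_star F N p m n s r t ((N - K_entangled_poly p m n N) %/ 2)%N].
Proof.
(* The threshold [N] supplies the [N] distinct evaluation points. *)
exists N => F [x x_inj] s r t s0 r0 t0 ps mr nt [f0 [g0 [lin0 rec0]]] mn1.
set d := (N - _)%N.
have code_ex : exists (f : encoding F N p m s r) (g : encoding F N p n s t),
    entangled_poly_code f g.
  rewrite /entangled_poly_code; case: leqP => _; last by exists f0, g0.
  exists (fun i A =>
    \sum_(j < p) \sum_(k < m) x i ^+ (j + k * p) *: block A j k).
  exists (fun i B =>
    \sum_(j < p) \sum_(k < n) x i ^+ (p - 1 - j + k * p * m) *: block B j k).
  by exists x.
have bound (f : encoding F N p m s r) (g : encoding F N p n s t) E :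
    linear_code f g -> separating f g E -> (E <= d)%N.
  exact: separating_le.
have code_sep (f : encoding F N p m s r) (g : encoding F N p n s t) :
    entangled_poly_code f g -> linear_code f g /\ separating f g d.
  rewrite /entangled_poly_code /d /K_entangled_poly; case: leqP => leK.
    move=> [y [y_inj fgy]]; split; first exact: entangled_linear fgy.
    exact: entangled_separating fgy leK.
  (* Here [K = N], so [d = 0] and recoverability is exactly the required separation. *)
  by rewrite subnn => -[? /recoverableP].
have weaken (f : encoding F N p m s r) (g : encoding F N p n s t) E E' :
    (E <= E')%N -> separating f g E' -> separating f g E.
  by move=> le sep A B A' B' /sep; apply: leq_ltn_trans.
have code_max (f : encoding F N p m s r) (g : encoding F N p n s t) :
    entangled_poly_code f g -> is_E_detect f g d /\ is_E_correct f g (d %/ 2).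
  move=> /code_sep[lin sep]; split; split.
  - exact/can_detectP.
  - by move=> E /can_detectP; apply: bound.
  - by apply/can_correctP; apply: weaken sep; apply: leq_divM.
  - by move=> E /can_correctP /(bound _ _ _ lin); rewrite leq_divRL.
have [f [g fg]] := code_ex; have [lin sep] := code_sep f g fg.
have rec : recoverable f g by apply/recoverableP; apply: weaken sep.
have [det cor] := code_max f g fg.
split=> //; split; [by exists f, g| |by exists f, g|] => f' g' lin' /recoverableP rec'.
  apply: is_max_exists => [|E /can_detectP]; first exact/can_detectP.
  exact: bound.
apply: is_max_exists => [|E /can_correctP /(bound _ _ _ lin')].
  exact/can_correctP.
by rewrite leq_divRL.
Qed.
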